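(* Let $X$ be any domain and $\mathcal{H}\subseteq 2^X$ any hypothesis class over $X$. A concept $c\subseteq X$ is approximable by $\mathcal{H}$ if and only if $c\in\mathrm{clos}(\sigma(\mathcal{H}))$.
   Context: Fix a $\sigma$-algebra on $X$; $\mathcal{P}(X)$ is the set of all probability distributions on $X$ with this $\sigma$-algebra. All concepts and hypotheses (subsets of $X$, identified with their indicator functions $X\to\{0,1\}$) are assumed measurable. $\sigma(\mathcal{H})$ is the smallest family of subsets of $X$ that contains $\mathcal{H}$, $\emptyset$ and $X$ and is closed under complements and countable unions. For a family $\mathcal{G}$ of subsets of $X$, $$\mathrm{clos}(\mathcal{G})=\{h\subseteq X:\ \forall P\in\mathcal{P}(X)\ \exists h_1,h_2,\ldots\in\mathcal{G}\ \text{such that}\ \lim_{n\to\infty}P(h\triangle h_n)=0\}.$$ An $\mathcal{H}$-based decision tree is a finite full binary tree $T$ in which every leaf holds a label in $\{0,1\}$ and every internal node $v$ holds a function $f_v\in\mathcal{H}$; a point $x$ is routed from the root to a leaf, going at node $v$ to the child determined by $f_v(x)$, and $T(x)$ is the label of the leaf reached. A concept $c$ is approximable by $\mathcal{H}$ if for every $P\in\mathcal{P}(X)$ and every $\varepsilon>0$ there exists an $\mathcal{H}$-based decision tree $T$ with $\Pr_{x\sim P}(T(x)\ne c(x))\le\varepsilon$. *)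

(* Defs.v *)
(* MathComp-Analysis *)
From HB Require Import structures.
From mathcomp Require Import all_boot all_order all_algebra.
From mathcomp Require Import all_classical all_reals all_analysis.

Set Implicit Arguments.
Unset Strict Implicit.
Unset Printing Implicit Defensive.

Import Order.TTheory GRing.Theory Num.Theory.
Import numFieldNormedType.Exports.

Local Open Scope classical_set_scope.
Local Open Scope ring_scope.

(* Each node carries a proof that its query belongs to [H], so every tree of
   this type is H-based. In [Node f _ t0 t1], [t0] is the child for f(x) = 0
   and [t1] the child for f(x) = 1. *)
Inductive dtree (X : Type) (H : set (set X)) : Type :=
| Leaf of bool
| Node (f : set X) of H f & dtree H & dtree H.

Fixpoint dtree_eval (X : Type) (H : set (set X)) (T : dtree H) (x : X) : bool :=
  match T with
  | Leaf b => b
  | Node f _ t0 t1 => if x \in f then dtree_eval t1 x else dtree_eval t0 x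
  end.

(* The error set is measurable as soon as [c] and the members of [H] are; [P]
   is meaningful only on measurable sets. *)
Definition approximable (R : realType) (d : measure_display)
    (X : measurableType d) (H : set (set X)) (c : set X) : Prop :=
  forall (P : probability X R) (eps : R), 0 < eps ->
    exists T : dtree H,
      (P [set x | dtree_eval T x != (x \in c)] <= eps%:E)%E.

(* [G] is meant to be a family of measurable sets; [h] ranges over measurable
   sets, and [h `+` k] is the symmetric difference. *)
Definition clos (R : realType) (d : measure_display) (X : measurableType d)
    (G : set (set X)) : set (set X) :=
  [set h | measurable h /\
    forall P : probability X R, exists h_ : (set X)^nat,
      (forall n, G (h_ n)) /\ P (h `+` h_ n) @[n --> \oo] --> 0%E].

(* Main.v *)
(* For a fixed distribution P, the measurable sets that decision trees
   approximate within every eps form a sigma-algebra containing H: swapping the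
   leaf labels gives complements, grafting a tree onto the 0-leaves of another
   gives finite unions, and continuity of P reduces countable unions to finite
   ones. Conversely, a single tree computes a finite Boolean combination of its
   queries, hence a set in <<s H>>. *)
Require Import Defs.
From HB Require Import structures.
From mathcomp Require Import all_boot all_order all_algebra.
From mathcomp Require Import all_classical all_reals all_analysis.

Set Implicit Arguments.
Unset Strict Implicit.
Unset Printing Implicit Defensive.

Import Order.TTheory GRing.Theory Num.Theory.

Local Open Scope classical_set_scope.

Section Trees.
Variables (X : Type) (H : set (set X)).

Definition dtree_set (T : dtree H) : set X := [set x | dtree_eval T x].

Fixpoint dtree_neg (T : dtree H) : dtree H :=
  match T with
  | Leaf b => Leaf H (~~ b)
  | Node f Hf t0 t1 => Node Hf (dtree_neg t0) (dtree_neg t1)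
  end.

Fixpoint dtree_or (T U : dtree H) : dtree H :=
  match T with
  | Leaf b => if b then Leaf H true else U
  | Node f Hf t0 t1 => Node Hf (dtree_or t0 U) (dtree_or t1 U)
  end.

Lemma dtree_set_neg T : dtree_set (dtree_neg T) = ~` dtree_set T.
Proof.
have evalN x : dtree_eval (dtree_neg T) x = ~~ dtree_eval T x.
  by elim: T => //= f _ t0 -> t1 ->; case: ifP.
by apply/seteqP; split => x; rewrite /dtree_set /= evalN => /negP.
Qed.

Lemma dtree_set_or T U : dtree_set (dtree_or T U) = dtree_set T `|` dtree_set U.
Proof.
have evalU x : dtree_eval (dtree_or T U) x = dtree_eval T x || dtree_eval U x.
  by elim: T => [[]|f _ t0 IH0 t1 IH1] //=; case: ifP.
by apply/seteqP; split => x; rewrite /dtree_set /= evalU => /orP.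
Qed.

Lemma dtree_set_leaf b : dtree_set (Leaf H b) = if b then setT else set0.
Proof. by case: b; apply/seteqP; split. Qed.

(** Turns routing at a node into a Boolean combination, the form on which induction over trees
    inside [<<s H >>] can act. *)
Lemma dtree_set_node f (Hf : H f) t0 t1 :
  dtree_set (Node Hf t0 t1) =
  (f `&` dtree_set t1) `|` (~` f `&` dtree_set t0).
Proof.
apply/seteqP; split => x; rewrite /dtree_set /=.
  by case: ifPn => [/set_mem ? ?|/negP nfx ?]; [left|right; split => // /mem_set].
by case=> -[fx ?]; [rewrite mem_set|rewrite memNset].
Qed.

Lemma dtree_set_query f (Hf : H f) :
  dtree_set (Node Hf (Leaf H false) (Leaf H true)) = f.
Proof. by rewrite dtree_set_node !dtree_set_leaf setIT setI0 setU0. Qed.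

(** Links the pointwise error of [approximable] with the symmetric difference of [clos]. *)
Lemma dtree_error_set T c :
  [set x | dtree_eval T x != (x \in c)] = c `+` dtree_set T.
Proof.
apply/seteqP; split => x; rewrite /dtree_set /setY /=.
  case: (boolP (x \in c)) => [/set_mem|/negP nc] /=.
    by rewrite eqb_id => cx /negP; left.
  rewrite eqbF_neg negbK => Tx; right; split => // cx.
  by apply: nc; exact: mem_set.
case=> -[cx Tx]; first by rewrite mem_set// eqb_id; apply/negP.
by rewrite memNset// eqbF_neg negbK.
Qed.

Lemma sigma_algebra_dtree_set T : <<s H >> (dtree_set T).
Proof.
have [s0 sC sU] := smallest_sigma_algebra setT H.
have sigmaC A : <<s H >> A -> <<s H >> (~` A) by rewrite -setTD; exact: sC.
have sigmaU A B : <<s H >> A -> <<s H >> B -> <<s H >> (A `|` B).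
  (* The pair is padded with empty sets into a sequence, so that countable unions cover binary
     ones. *)
  move=> sA sB; rewrite -bigcup2E; apply: sU => -[//|[//|n]].
  exact: s0.
have sigmaI A B : <<s H >> A -> <<s H >> B -> <<s H >> (A `&` B).
  move=> sA sB; rewrite -(setCK (A `&` B)) setCI.
  exact: sigmaC _ (sigmaU _ _ (sigmaC _ sA) (sigmaC _ sB)).
elim: T => [b|f Hf t0 IH0 t1 IH1].
  rewrite dtree_set_leaf; case: b => //.
  by have := sigmaC _ s0; rewrite setC0.
have sf : <<s H >> f by exact: sub_sigma_algebra.
rewrite dtree_set_node; apply: (sigmaU _ _).
  exact: (sigmaI _ _ sf IH1).
exact: (sigmaI _ _ (sigmaC _ sf) IH0).
Qed.

End Trees.

Section Approximation.
Context (R : realType) (d : measure_display) (X : measurableType d).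
Implicit Types (P : probability X R) (A B C D : set X).

Lemma measurable_setY A B :
  measurable A -> measurable B -> measurable (A `+` B).
Proof. by move=> mA mB; apply: measurableU; exact: measurableD. Qed.

Lemma probability_setY_triangle P A B C :
  measurable A -> measurable B -> measurable C ->
  (P (A `+` C) <= P (A `+` B) + P (B `+` C))%E.
Proof.
move=> mA mB mC.
have mAB := measurable_setY mA mB; have mBC := measurable_setY mB mC.
apply: le_trans (measureU2 P mAB mBC).
apply: le_measure; rewrite ?inE; [exact: measurable_setY|exact: measurableU|].
(* A point separating [A] from [C] separates [B] from one of them; which one depends on whether it
   lies in [B]. *)
by move=> x; rewrite /setY /=; have [] := pselect (B x); tauto.
Qed.

Lemma probability_setY_setU P A B C D :
  measurable A -> measurable B -> measurable C -> measurable D ->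
  (P ((A `|` B) `+` (C `|` D)) <= P (A `+` C) + P (B `+` D))%E.
Proof.
move=> mA mB mC mD.
have mAC := measurable_setY mA mC; have mBD := measurable_setY mB mD.
apply: le_trans (measureU2 P mAC mBD).
apply: le_measure; rewrite ?inE.
- by apply: measurable_setY; exact: measurableU.
- exact: measurableU.
- by move=> x; rewrite /setY /=; tauto.
Qed.

(** Partial unions lie inside the full union, so only a one-sided difference remains; it decreases
    to the empty set, and continuity from above of the finite measure [P] applies. *)
Lemma cvg_bigsetU_setY P (F : (set X)^nat) :
  (forall n, measurable (F n)) ->
  P (\bigcup_n F n `+` \big[setU/set0]_(i < n) F i) @[n --> \oo] --> 0%E.
Proof.
move=> mF; pose U n := \big[setU/set0]_(i < n) F i.
have mU n : measurable (U n) by exact: bigsetU_measurable.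
have mUF : measurable (\bigcup_n F n) by exact: bigcup_measurable.
have YD n : \bigcup_n F n `+` U n = \bigcup_n F n `\` U n.
  by rewrite /setY (_ : U n `\` _ = set0) ?setU0// setD_eq0; exact: bigsetU_bigcup.
have DF : \bigcap_n (\bigcup_n F n `\` U n) = set0.
  apply/seteqP; split => // x UFx.
  (* Index 0 only yields some [k] with [x] in [F k]; the partial union at [k.+1] is the first to
     include [F k], a contradiction. *)
  have [[k _ Fkx] _] := UFx 0%N I.
  have [_] := UFx k.+1 I; apply.
  by rewrite /U big_ord_recr; right.
rewrite (_ : 0%E = P (\bigcap_n (\bigcup_n F n `\` U n))); last first.
  by rewrite DF measure0.
under eq_fun do rewrite YD.
apply: nonincreasing_cvg_mu.
- by apply: le_lt_trans (probability_le1 _ _) (ltry _); exact: measurableD.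
- by move=> n; exact: measurableD.
- by rewrite DF.
- by move=> m n mn; apply/subsetPset; apply: setDS; exact: subset_bigsetU.
Qed.

Lemma cvge0_le (u : (\bar R)^nat) (eps : R) : (0 < eps)%R ->
  u @ \oo --> 0%E -> exists n, (u n <= eps%:E)%E.
Proof.
move=> e0 u0.
have [n _ un] : \forall n \near \oo, (u n < eps%:E)%E.
  apply: (u0 [set x | (x < eps%:E)%E]).
  by apply: open_nbhs_nbhs; split; [exact: open_ereal_lt_ereal|rewrite /= lte_fin].
by exists n; apply/ltW/un => /=.
Qed.

Variable H : set (set X).
Hypothesis mH : H `<=` measurable.

Lemma measurable_dtree_set (T : dtree H) : measurable (dtree_set T).
Proof.
exact: (smallest_sub (@sigma_algebra_measurable _ X) mH (sigma_algebra_dtree_set T)).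
Qed.

Definition dtree_approx P A := measurable A /\
  forall eps : R, (0 < eps)%R ->
    exists T : dtree H, (P (A `+` dtree_set T) <= eps%:E)%E.

(** Closedness in the pseudometric [P (A]+[B)], by the triangle inequality with [eps / 2] on each
    side. It serves both countable unions and the passage from [<<s H >>] to its closure. *)
Lemma dtree_approx_closed P A : measurable A ->
  (forall eps : R, (0 < eps)%R ->
    exists2 B, dtree_approx P B & (P (A `+` B) <= eps%:E)%E) ->
  dtree_approx P A.
Proof.
move=> mA appA; split => // eps e0.
have e20 : (0 < eps / 2)%R by rewrite divr_gt0.
have [B [mB /(_ _ e20)[T BT]] AB] := appA _ e20.
exists T.
have mT := measurable_dtree_set T.
apply: le_trans (probability_setY_triangle P mA mB mT) _.
by rewrite (splitr eps) EFinD leeD.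
Qed.

Lemma dtree_approx_dtree P (T : dtree H) : dtree_approx P (dtree_set T).
Proof.
split; first exact: measurable_dtree_set.
by move=> eps e0; exists T; rewrite /setY setDv setU0 measure0 lee_fin ltW.
Qed.

Lemma dtree_approx_setU P A B :
  dtree_approx P A -> dtree_approx P B -> dtree_approx P (A `|` B).
Proof.
move=> [mA appA] [mB appB]; split; first exact: measurableU.
move=> eps e0; have e20 : (0 < eps / 2)%R by rewrite divr_gt0.
have [[T AT] [U BU]] := (appA _ e20, appB _ e20).
exists (dtree_or T U); rewrite dtree_set_or.
apply: le_trans (probability_setY_setU P mA mB _ _) _.
1,2: exact: measurable_dtree_set.
by rewrite (splitr eps) EFinD leeD.
Qed.

Lemma sigma_algebra_dtree_approx P : sigma_algebra setT (dtree_approx P).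
Proof.
have app0 : dtree_approx P set0.
  by have := dtree_approx_dtree P (Leaf H false); rewrite dtree_set_leaf.
split => // [A [mA appA]|F appF].
  rewrite setTD; split; first exact: measurableC.
  move=> eps /appA[T AT]; exists (dtree_neg T).
  (* Complementing both sets leaves their symmetric difference unchanged, so the error is the
     same. *)
  by rewrite dtree_set_neg /setY !setDE !setCK setUC setIC [X in _ `|` X]setIC.
have mF n : measurable (F n) by have [] := appF n.
apply: dtree_approx_closed => [|eps e0]; first exact: bigcup_measurable.
have [n Fn] := cvge0_le e0 (cvg_bigsetU_setY P mF).
exists (\big[setU/set0]_(i < n) F i) => //.
by elim/big_ind : _ => // A B; exact: dtree_approx_setU.
Qed.

Lemma sub_sigma_algebra_dtree_approx P : <<s H >> `<=` dtree_approx P.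
Proof.
apply: smallest_sub; first exact: sigma_algebra_dtree_approx.
by move=> f Hf; rewrite -(dtree_set_query Hf); exact: dtree_approx_dtree.
Qed.

End Approximation.

Theorem theorem7 (R : realType) (d : measure_display) (X : measurableType d)
    (H : set (set X)) (mH : H `<=` measurable)
    (c : set X) (mc : measurable c) :
  approximable R H c <-> clos R <<s H >> c.
Proof.
split=> [appc|[_ closc] P eps e0].
  split=> // P.
  (* Tolerances 1/(n+1) are positive for every [n] and tend to 0; the trees may depend on [P], as
     [clos] allows. *)
  have /choice[T cT] n : exists T : dtree H,
      (P (c `+` dtree_set T) <= (harmonic n)%:E)%E.
    have [|T] := appc P (harmonic n); first exact: harmonic_gt0.
    by rewrite dtree_error_set; exists T.
  exists (fun n => dtree_set (T n)); split.
    by move=> n; exact: sigma_algebra_dtree_set.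
  apply: (squeeze_cvge _ (cvg_cst 0%E) cvge_harmonic).
  by apply: nearW => n; rewrite measure_ge0 /=; exact: cT.
have [h_ [sh h0]] := closc P.
(* For this fixed [P], each [h_ n] is a limit of trees and [c] is a limit of the [h_ n]. *)
have [|_ /(_ _ e0)[T cT]] := @dtree_approx_closed _ _ _ _ mH P c mc.
  move=> e /cvge0_le/(_ h0)[n hn]; exists (h_ n) => //.
  exact: (sub_sigma_algebra_dtree_approx mH P (sh n)).
by exists T; rewrite dtree_error_set.
Qed.
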